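(* Fix an integer $n$ and $\varepsilon\in[2/n,1/2]$. Suppose $\mathrm{sk}$ is a (randomized) sketching algorithm that outputs at most $s=s(n,\varepsilon)$ bits, and $\mathrm{est}$ is an estimation algorithm, such that together, for every unweighted $n$-vertex graph $G=(V,E)$ and every subset $S\subset V$, $$\Pr\Big[\mathrm{est}(S,\mathrm{sk}(G))\in(1\pm\varepsilon)\cdot|E(S,\bar S)|\Big]\ge9/10.$$ Then $s\ge\Omega(n/\varepsilon)$.
   Context: $E(S,\bar S)$ is the set of edges with exactly one endpoint in $S$, $\bar S=V\setminus S$; $x\in(1\pm\varepsilon)y$ means $(1-\varepsilon)y\le x\le(1+\varepsilon)y$. The $\Omega(\cdot)$ hides an absolute constant. *)

(* Defs.v *)
From HB Require Import structures.
From mathcomp Require Import all_boot all_order all_algebra.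
From mathcomp Require Import all_classical all_reals all_analysis.
Import Order.TTheory GRing.Theory Num.Theory.

Set Implicit Arguments.
Unset Strict Implicit.
Unset Printing Implicit Defensive.

Local Open Scope ring_scope.
Local Open Scope classical_set_scope.

(* Finite simple graphs on the vertex set {0, ..., n-1}; an edge is a
   2-element set of vertices. *)
Record sgraph (n : nat) := SGraph {
  edges :> {set {set 'I_n}} ;
  edges_card2 : [forall e in edges, #|e| == 2%N] }.

HB.instance Definition _ (n : nat) := [isSub for @edges n].
HB.instance Definition _ (n : nat) := [Finite of sgraph n by <:].

Definition cut_edges (n : nat) (G : sgraph n) (S : {set 'I_n}) :
    {set {set 'I_n}} :=
  [set e in edges G | #|e :&: S| == 1%N]%SET.

Definition approx (R : realType) (eps y x : R) : Prop :=
  (1 - eps) * y <= x <= (1 + eps) * y.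

(* [sk w1 G] is the bit string output on G with coins w1; a string takes
   finitely many values once its length is bounded, so measurability is stated
   on the fibres. *)
Definition sketch_measurable (d : measure_display) (T : measurableType d)
    (n : nat) (sk : T -> sgraph n -> seq bool) : Prop :=
  forall (G : sgraph n) (b : seq bool), measurable [set w | sk w G = b].

Definition est_measurable (R : realType) (d : measure_display)
    (T : measurableType d) (n : nat)
    (est : T -> {set 'I_n} -> seq bool -> R) : Prop :=
  forall (S : {set 'I_n}) (b : seq bool),
    measurable_fun setT (fun w => est w S b).

(* The coins of [sk] and of [est] are independent, so [est] learns about G and
   about the coins of [sk] only through the sketch; a deterministic [est] is
   the case where it ignores its coins. *)
Definition success_event (R : realType) (T1 T2 : Type) (n : nat) (eps : R)
    (sk : T1 -> sgraph n -> seq bool)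
    (est : T2 -> {set 'I_n} -> seq bool -> R)
    (G : sgraph n) (S : {set 'I_n}) : set (T1 * T2) :=
  [set w | approx eps #|cut_edges G S|%:R (est w.2 S (sk w.1 G))].

(* Main.v *)
Require Import Defs.
From HB Require Import structures.
From mathcomp Require Import all_boot all_order all_algebra.
From mathcomp Require Import all_classical all_reals all_analysis.
From mathcomp Require Import measurable_realfun.
From mathcomp Require Import ring lra zify.
Import Order.TTheory GRing.Theory Num.Theory.
Set Implicit Arguments.
Unset Strict Implicit.
Unset Printing Implicit Defensive.
Local Open Scope ring_scope.

(** A sketch of accuracy [eps] is a randomized code for a bit string of length
    [Omega(n / eps)] from which each single bit can be recovered with probability
    [7/10].  Put [m] disjoint copies of a [k] by [k] bipartite graph on the
    vertices, with [k] of order [1/eps] and [m] of order [n * eps], and let each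
    of the [m * k^2] potential edges [uv] carry a bit.  The cuts of [{u}], [{v}]
    and [{u, v}] satisfy [d(u) + d(v) - d(u, v) = 2 * [uv is an edge]], all of
    them are at most [2 * k], so the estimates of these three cuts determine
    the bit.

    Such a code needs a number of bits linear in the length [N]: a guess string
    agrees with [x] on [a(x)] positions, and for a fixed guess the sum over [x]
    of [2^a(x)] is [3^N].  With [M] possible sketches the sum over [x] of
    [2^a(x)] is thus at most [M * 3^N], while by convexity it is at least
    [2^N * 2^(7N/10)], and [2^(17/10) > 3]. *)

(** * Counting agreements between strings and guesses *)

Definition agreement (I : finType) (x y : {set I}) : {set I} :=
  [set i | (i \in x) == (i \in y)].

Lemma agreementK (I : finType) (y : {set I}) :
  involutive (fun x => agreement x y).
Proof.
by move=> x; apply/setP => i; rewrite !inE; case: (i \in x); case: (i \in y).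
Qed.

Lemma card_set_type (I : finType) : #|{set I}| = (2 ^ #|I|)%N.
Proof. 
by have := card_powerset [set: I]; rewrite finset.powersetT !cardsT.
Qed.

(** Expand [(2 + 1) ^ #|I|]: the set [A] collects the factors from which the [2] is taken. *)
Lemma sum_exp2_card (I : finType) :
  (\sum_(A : {set I}) 2 ^ #|A| = 3 ^ #|I|)%N.
Proof.
have -> : (3 ^ #|I| = \prod_(i : I) (2 + 1))%N by rewrite prod_nat_const.
rewrite bigA_distr; apply: eq_bigr => A _.
by rewrite -big_mkcond /= prod_nat_const.
Qed.

Lemma sum_exp2_agreement (I : finType) (y : {set I}) :
  (\sum_(x : {set I}) 2 ^ #|agreement x y| = 3 ^ #|I|)%N.
Proof.
rewrite -sum_exp2_card [RHS](reindex_inj (inv_inj (agreementK y))).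
by [].
Qed.

(** Enlarge the sum from the single sketch [enc x] to all strings [b] of length at most [s]. After
    exchanging the sums, each guess [dec b] is independent of [x] and contributes [3 ^ #|I|]. *)
Lemma sum_exp2_agreement_code (I : finType) (s : nat)
    (enc : {set I} -> s.-bseq bool) (dec : s.-bseq bool -> {set I}) :
  (\sum_(x : {set I}) 2 ^ #|agreement x (dec (enc x))|
     <= (2 ^ s.+1).-1 * 3 ^ #|I|)%N.
Proof.
have -> : ((2 ^ s.+1).-1 * 3 ^ #|I| =
    \sum_(b : s.-bseq bool) \sum_(x : {set I}) 2 ^ #|agreement x (dec b)|)%N.
  rewrite (eq_bigr _ (fun b _ => sum_exp2_agreement (dec b))).
  by rewrite sum_nat_const card_bseq card_bool predn_exp mul1n.
rewrite exchange_big; apply: leq_sum => x _.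
by rewrite (bigD1 (enc x)) //= leq_addr.
Qed.

(** * From success probabilities to the size of a code *)

Lemma sum_probability_le (R : realType) (d : measure_display)
    (T : measurableType d) (P : probability T R) (J : finType)
    (A : J -> set T) (B : R) :
  (forall j, measurable (A j)) ->
  (forall w, \sum_j \1_(A j) w <= B) ->
  (\sum_j P (A j) <= B%:E)%E.
Proof.
move=> mA AB.
have -> : (\sum_j P (A j) = \int[P]_w (\sum_j \1_(A j) w)%:E)%E.
  under [RHS]eq_integral do rewrite -sumEFin.
  rewrite ge0_integral_sum //.
  - by apply: eq_bigr => j _; rewrite integral_indic // setIT.
  - by move=> j; apply/measurable_EFinP; exact: measurable_indic.
apply: (@le_trans _ _ (\int[P]_w cst B%:E w)%E).
  apply: ge0_le_integral => //.
  - by move=> w _; rewrite lee_fin; apply: sumr_ge0.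
  - by apply/measurable_EFinP; apply: measurable_sum => j; exact: measurable_indic.
  - by move=> w _; rewrite lee_fin.
by rewrite /= integral_cst //= probability_setT mule1.
Qed.

Lemma probability_setI (R : realType) (d : measure_display)
    (T : measurableType d) (P : probability T R) (A B : set T) (a b : R) :
  measurable A -> measurable B ->
  (a%:E <= P A)%E -> (b%:E <= P B)%E ->
  ((a + b - 1)%:E <= P (A `&` B)%classic)%E.
Proof.
move=> mA mB aA bB.
have : (P (~` (A `&` B)) <= P (~` A) + P (~` B))%E%classic.
  by rewrite setCI; apply: measureU2; exact: measurableC.
rewrite !probability_setC //; last exact: measurableI.
move: aA bB.
rewrite -(fineK (fin_num_measure P _ mA)) -(fineK (fin_num_measure P _ mB)).
rewrite -(fineK (fin_num_measure P _ (measurableI _ _ mA mB))).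
rewrite -!EFinB -EFinD !lee_fin; lra.
Qed.

(** The exact count [(2 ^ s.+1).-1] matters only for [s = 0], where it equals 1 and contradicts
    [0 < N]. For [s >= 1], the cruder [N <= 10 * (s + 1)] is at most [20 * s]. *)
Lemma code_size_lower_bound (N s : nat) :
  (0 < N)%N -> (2 ^ N <= (2 ^ s.+1).-1 ^ 10)%N -> (N <= 20 * s)%N.
Proof.
case: s => [|s] N0 h.
  by move: h; rewrite expn1 exp1n; case: N N0 => // N _; rewrite expnS; lia.
have : (2 ^ N <= 2 ^ (s.+2 * 10))%N.
  by apply: leq_trans h _; rewrite expnM leq_exp2r // leq_pred.
rewrite leq_exp2l //; lia.
Qed.

Lemma index_lower_bound (R : realType) (d : measure_display)
    (T : measurableType d) (P : probability T R) (I : finType) (s : nat)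
    (enc : T -> {set I} -> seq bool) (dec : T -> seq bool -> {set I})
    (A : {set I} -> I -> set T) :
  (0 < #|I|)%N ->
  (forall w x, (size (enc w x) <= s)%N) ->
  (forall x i, measurable (A x i)) ->
  (forall x i, ((7 / 10)%:E <= P (A x i))%E) ->
  (forall x i w, A x i w -> (i \in dec w (enc w x)) = (i \in x)) ->
  (#|I| <= 20 * s)%N.
Proof.
move=> I0 encs mA PA decA; set N := #|I| in I0 *.
apply: code_size_lower_bound => //.
pose l : R := ln 2; have l0 : 0 < l by rewrite ln_gt0 // ltr1n.
pose t : R := 7 / 10 * N%:R.
pose u := expR (l * t).
have u0 : 0 < u by exact: expR_gt0.
have u10 : u ^+ 10 = 2 ^+ (7 * N).
  rewrite -expRM_natl -[X in _ = X ^+ _](@lnK R) ?posrE ?ltr0n //.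
  rewrite -expRM_natl; congr expR; rewrite -/l /t natrM; lra.
pose M : R := (2 ^ s.+1).-1%:R.
(* The bound on the total agreement for fixed coins, obtained by summing the tangent-line inequality
   over [x] and solving for the agreement. *)
pose B := (M * 3 ^+ N / u - 2 ^+ N) / l + t * 2 ^+ N.
have pw w : \sum_(j : {set I} * I) \1_(A j.1 j.2) w <= B.
  pose y x := dec w (enc w x).
  have agr x : \sum_i (\1_(A x i) w : R) <= #|agreement x (y x)|%:R.
    rewrite -sum1_card natr_sum [leRHS]big_mkcond /=.
    apply: ler_sum => i _; rewrite inE indicE.
    case: (asboolP (A x i w)) => [Aw|nA]; last first.
      by rewrite memNset //; case: ifP.
    by rewrite /y (decA _ _ _ Aw) eqxx mem_set.
  (* Tangent line of [a |-> 2 ^ a] at the mean agreement [t], where [2 ^ t = u]. *)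
  have expa x : 1 + l * (\sum_i (\1_(A x i) w : R) - t)
      <= 2 ^+ #|agreement x (y x)| / u.
    apply: (@le_trans _ _ (expR (l * #|agreement x (y x)|%:R - l * t))).
      apply: le_trans _ (expR_ge1Dx _).
      by rewrite lerD2l -mulrBr ler_pM2l // lerD2r.
    rewrite expRB -/u [l * _%:R]mulrC expRM_natl lnK ?posrE ?ltr0n //.
  have := ler_sum (index_enum {set I}) (P := xpredT) (fun x _ => expa x).
  rewrite -mulr_suml big_split /= -mulr_sumr sumrB !sumr_const.
  rewrite card_set_type -/N (pair_bigA _ (fun x i => \1_(A x i) w : R)) /=.
  set Sm := \sum_p _ => le1.
  have le2 : \sum_x (2 ^+ #|agreement x (y x)| : R) <= M * 3 ^+ N.
    rewrite -natrX -natrM.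
    under eq_bigr do rewrite -natrX.
    rewrite -natr_sum ler_nat.
    apply: leq_trans (sum_exp2_agreement_code
       (fun x => Bseq (encs w x)) (fun b => dec w b)).
    by [].
  have {le1} : 2 ^+ N + l * (Sm - t * 2 ^+ N) <= M * 3 ^+ N / u.
    apply: le_trans (ler_wpM2r (ltW _) le2); last by rewrite invr_gt0.
    by apply: le_trans le1; rewrite -natrX mulr_natr.
  rewrite -lerBrDl mulrC -ler_pdivlMr // lerBlDr; exact.
have : 7 / 10 * (2 ^+ N * N%:R) <= B.
  rewrite -lee_fin.
  apply: le_trans (sum_probability_le P (fun j => mA j.1 j.2) pw) => //.
  apply: (@le_trans _ _ (\sum_(j : {set I} * I) (7 / 10)%:E)%E); last first.
    by apply: lee_sum.
  rewrite sumEFin sumr_const card_prod card_set_type -/N lee_fin.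
  by rewrite -natrX -natrM mulr_natr.
have -> : 7 / 10 * (2 ^+ N * N%:R) = t * 2 ^+ N by rewrite /t; ring.
(* The term [t * 2 ^+ N] cancels, leaving [2 ^+ N * u <= M * 3 ^+ N]; tenth powers then make every
   exponent an integer. *)
rewrite lerDr pmulr_lge0 ?invr_gt0 // subr_ge0 ler_pdivlMr // => main.
have : (2 ^+ N * u) ^+ 10 <= (M * 3 ^+ N) ^+ 10.
  by rewrite lerXn2r // nnegrE ?mulr_ge0 ?exprn_ge0 // ltW.
rewrite !exprMn u10 -!exprM => main10.
(* Since [3 ^ 10 = 59049 < 65536 = 2 ^ 16], one factor [2 ^ N] survives out of [2 ^ (17 * N)]. *)
have le316 : (3 ^+ (N * 10) : R) <= 2 ^+ (16 * N).
  rewrite mulnC !exprM lerXn2r // ?nnegrE ?exprn_ge0 //.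
  by rewrite -!natrX ler_nat.
rewrite -(ler_nat R) !natrX -/M.
rewrite -(@ler_pM2r _ (2 ^+ (16 * N))) ?exprn_gt0 //.
apply: le_trans _ (ler_wpM2l _ le316); last by rewrite exprn_ge0.
apply: le_trans main10.
by rewrite -!exprD (_ : (N + 16 * N = N * 10 + 7 * N)%N) //; lia.
Qed.

(** * Cuts of one and two vertices *)

(** Compare the contributions edge by edge: only an edge containing both [u] and [v] is counted
    differently, and that edge is [[set u; v]]. *)
Lemma card_cut_edges1D (n : nat) (G : sgraph n) (u v : 'I_n) : u != v ->
  (#|cut_edges G [set u]| + #|cut_edges G [set v]| =
   #|cut_edges G [set u; v]| + 2 * ([set u; v] \in edges G))%N.
Proof.
move=> uv.
have cutE S : #|cut_edges G S| = (\sum_(e in edges G) (#|e :&: S| == 1))%N.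
  rewrite -sum1_card (eq_bigl (fun e => (e \in edges G) && (#|e :&: S| == 1%N))).
    by rewrite big_mkcondr; apply: eq_bigr => e _; case: eqP.
  by move=> e; rewrite inE.
have -> : ([set u; v] \in edges G : nat) =
    (\sum_(e in edges G) (e == [set u; v]))%N.
  have [uvG|uvG] := boolP ([set u; v] \in edges G).
    rewrite (bigD1 [set u; v]) //= eqxx big1 // => e /andP[_].
    by move=> /negPf ->.
  by rewrite big1 // => e eG; apply/eqP; rewrite eqb0; apply: contraNneq uvG => <-.
rewrite !cutE big_distrr -!big_split; apply: eq_bigr => e eG /=.
have e2 : #|e| = 2%N by apply/eqP; exact: (implyP (forallP (edges_card2 G) e)).
have cI1 w : #|e :&: [set w]| = (w \in e) :> nat.
  have [we|we] := boolP (w \in e).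
    by rewrite (finset.setIidPr _) ?cards1 // finset.sub1set.
  by apply/eqP; rewrite cards_eq0 finset.setIC finset.setI_eq0 disjoints1.
have cI2 : #|e :&: [set u; v]| = ((u \in e) + (v \in e))%N.
  rewrite finset.setIUr cardsU !cI1 -finset.setIIr.
  suff -> : [set u] :&: [set v] = finset.set0 by rewrite finset.setI0 cards0 subn0.
  apply/setP => w; rewrite !inE; apply/negbTE; apply: contraNN uv.
  by move=> /andP[/eqP <- /eqP ->].
have -> : (e == [set u; v]) = (u \in e) && (v \in e).
  have [/andP[ue ve]|] := boolP ((u \in e) && (v \in e)).
    rewrite eq_sym eqEcard e2 cards2 uv andbT.
    by apply/fintype.subsetP => w; rewrite !inE => /orP[] /eqP ->.
  apply: contraNF => /eqP ->; by rewrite !inE !eqxx orbT.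
by rewrite cI2 !cI1; case: (u \in e); case: (v \in e).
Qed.

Lemma mem_cut_edges1 (n : nat) (G : sgraph n) (v : 'I_n) (e : {set 'I_n}) :
  e \in cut_edges G [set v] -> (e \in edges G) && (v \in e).
Proof.
rewrite inE => /andP[-> /eqP ev] /=; apply: contraPT ev => /negPf ve.
suff -> : e :&: [set v] = finset.set0 by rewrite cards0.
by apply/setP => w; rewrite !inE; case: eqP => [->|]; rewrite ?ve ?andbF.
Qed.

Lemma card_missing (K : finType) (A : {set K}) (q : K) (b : bool) :
  (b -> q \notin A) -> (#|A| + b <= #|K|)%N.
Proof.
case: b => [/(_ isT) qA|_]; last by rewrite addn0 max_card.
rewrite addn1; have := cardsC A; have : (0 < #|~: A|)%N.
  by apply/card_gt0P; exists q; rewrite inE.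
lia.
Qed.

(** * The graph that stores a bit string in bipartite blocks *)

Section CodeGraph.
Variables (m k n : nat) (f : 'I_m * bool * 'I_k -> 'I_n).
Hypothesis f_inj : injective f.
Local Notation bit := ('I_m * 'I_k * 'I_k)%type.

(** The map [f] places the vertices, indexed by block, side and position. A bit [(j, p, q)] is the
    potential edge of block [j] from left position [p] to right position [q]. *)
Definition left_end (i : bit) : 'I_n := f (i.1.1, false, i.1.2).
Definition right_end (i : bit) : 'I_n := f (i.1.1, true, i.2).
Definition bit_edge (i : bit) : {set 'I_n} := [set left_end i; right_end i].

Lemma left_right_neq (i i' : bit) : left_end i != right_end i'.
Proof. by apply/eqP => /f_inj. Qed.

Lemma left_end_inj (i i' : bit) : left_end i = left_end i' -> i.1 = i'.1.
Proof. by move=> /f_inj[]; case: i i' => [[j p] q] [[j' p'] q'] /= -> ->. Qed.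

Lemma right_end_inj (i i' : bit) :
  right_end i = right_end i' -> i.1.1 = i'.1.1 /\ i.2 = i'.2.
Proof. by move=> /f_inj[]. Qed.

Lemma mem_left_end (i i' : bit) :
  left_end i \in bit_edge i' -> i.1 = i'.1.
Proof.
rewrite !inE (negPf (left_right_neq _ _)) orbF => /eqP; exact: left_end_inj.
Qed.

Lemma mem_right_end (i i' : bit) :
  right_end i \in bit_edge i' -> i.1.1 = i'.1.1 /\ i.2 = i'.2.
Proof.
rewrite !inE eq_sym (negPf (left_right_neq _ _)) /= => /eqP.
exact: right_end_inj.
Qed.

Lemma bit_edge_inj : injective bit_edge.
Proof.
move=> i i' ii'.
have /mem_left_end : left_end i \in bit_edge i' by rewrite -ii' !inE eqxx.
have /mem_right_end[_] : right_end i \in bit_edge i'.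
  by rewrite -ii' !inE eqxx orbT.
by case: i i' {ii'} => [jp q] [jp' q'] /= -> ->.
Qed.

Lemma code_edges_card2 (x : {set bit}) :
  [forall e in bit_edge @: x, #|e| == 2%N].
Proof.
apply/forall_inP => _ /imsetP[i _ ->].
by rewrite cards2 left_right_neq.
Qed.

Definition code_graph (x : {set bit}) : sgraph n :=
  SGraph (code_edges_card2 x).

Lemma mem_code_graph (x : {set bit}) (i : bit) :
  (bit_edge i \in edges (code_graph x)) = (i \in x).
Proof. exact/mem_imset/bit_edge_inj. Qed.

Lemma card_cut_left_end (x : {set bit}) (i : bit) :
  (#|cut_edges (code_graph x) [set left_end i]| + (i \notin x) <= k)%N.
Proof.
pose A := [set q | (i.1, q) \in x]%SET.
apply: (@leq_trans (#|A| + (i \notin x))%N).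
  rewrite leq_add2r.
  apply: leq_trans (leq_imset_card (fun q => bit_edge (i.1, q)) _).
  apply/subset_leq_card/fintype.subsetP => e /mem_cut_edges1/andP[].
  move=> /imsetP[[jp q] xi ->] /mem_left_end /= ijp; subst jp.
  by apply/imsetP; exists q; rewrite ?inE.
rewrite -[leqRHS]card_ord; apply: (card_missing (q := i.2)).
by rewrite inE -surjective_pairing.
Qed.

Lemma card_cut_right_end (x : {set bit}) (i : bit) :
  (#|cut_edges (code_graph x) [set right_end i]| + (i \notin x) <= k)%N.
Proof.
pose A := [set p | (i.1.1, p, i.2) \in x]%SET.
apply: (@leq_trans (#|A| + (i \notin x))%N).
  rewrite leq_add2r.
  apply: leq_trans (leq_imset_card (fun p => bit_edge (i.1.1, p, i.2)) _).
  apply/subset_leq_card/fintype.subsetP => e /mem_cut_edges1/andP[].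
  move=> /imsetP[[[j p] q] xi ->] /mem_right_end /= [ij iq]; subst j q.
  by apply/imsetP; exists p; rewrite ?inE.
rewrite -[leqRHS]card_ord; apply: (card_missing (q := i.1.2)).
by rewrite inE -!surjective_pairing.
Qed.

End CodeGraph.

(** * Decoding a bit, and the choice of parameters *)

Lemma inj_of_leq_card (A B : finType) : (#|A| <= #|B|)%N ->
  exists f : A -> B, injective f.
Proof.
move=> AB; exists (fun a => enum_val (widen_ord AB (enum_rank a))).
move=> a a' /enum_val_inj /(congr1 val) /= /val_inj; exact: enum_rank_inj.
Qed.

(** The error of [a + b - c] is at most [eps * (du + dv + dw)]. If the edge is present,
    [dw <= 2 * k - 2], so the error is at most 1 below the true value 2. If it is absent, both
    degrees are at most [k - 1], and the error [eps * (4 * k - 4)] about 0 is strictly below 1. *)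
Lemma decode_threshold (R : realType) (eps a b c : R) (k du dv dw : nat)
    (h : bool) :
  0 < eps -> eps * (4 * k%:R - 2) <= 1 ->
  (du + dv = dw + 2 * h)%N -> (du + ~~ h <= k)%N -> (dv + ~~ h <= k)%N ->
  Defs.approx eps du%:R a -> Defs.approx eps dv%:R b -> Defs.approx eps dw%:R c ->
  (1 <= a + b - c) = h.
Proof.
move=> e0 ek duvw.
have dE : du%:R + dv%:R = dw%:R + 2 * h%:R :> R.
  by rewrite -natrM -!natrD duvw.
rewrite /Defs.approx -!(ler_nat R) !natrD => du_le dv_le.
move=> /andP[a1 a2] /andP[b1 b2] /andP[c1 c2].
have := ler_wpM2l (ltW e0) du_le; have := ler_wpM2l (ltW e0) dv_le.
have := congr1 (fun z => eps * z) dE.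
case: h dE {duvw du_le dv_le} => /= dE e1 e2 e3.
  by lra.
apply/negbTE; rewrite -ltNge; lra.
Qed.

(** Splitting by the value of the sketch gives a countable union of measurable rectangles. *)
Lemma measurable_success_event (R : realType) (d1 d2 : measure_display)
    (T1 : measurableType d1) (T2 : measurableType d2) (n : nat) (eps : R)
    (sk : T1 -> sgraph n -> seq bool) (est : T2 -> {set 'I_n} -> seq bool -> R)
    (G : sgraph n) (S : {set 'I_n}) :
  sketch_measurable sk -> est_measurable est ->
  measurable (success_event eps sk est G S).
Proof.
move=> msk mest; set y : R := #|cut_edges G S|%:R.
pose F (b : seq bool) := ([set w1 | sk w1 G = b] `*`
  ((fun w2 => est w2 S b) @^-1` `[(1 - eps) * y, (1 + eps) * y]))%classic.
have -> : success_event eps sk est G S = (\bigcup_b F b)%classic.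
  apply/seteqP; split => [w ws|w [b _ [/= <-]]].
    by exists (sk w.1 G) => //; split => //=; rewrite in_itv.
  by rewrite in_itv.
apply: countable_bigcupT_measurable => [|b]; first exact: countableP.
apply: measurableX; first exact: msk.
rewrite -[X in measurable X]setTI; apply: mest => //; exact: measurable_itv.
Qed.

Lemma block_parameters (R : realType) (n : nat) (eps : R) :
  (0 < n)%N -> 2 / n%:R <= eps -> eps <= 1 / 2 ->
  exists m k : nat, [/\ (m * 2 * k <= n)%N, (0 < m * k * k)%N,
    eps * (4 * k%:R - 2) <= 1 & n%:R / eps <= 32 * (m * k * k)%:R].
Proof.
move=> n0 en e2.
have n0' : 0 < n%:R :> R by rewrite ltr0n.
have e0 : 0 < eps by apply: lt_le_trans en; rewrite divr_gt0.
have n4 : 4 <= n%:R :> R.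
  by have := le_trans en e2; rewrite ler_pdivrMr //; lra.
pose z := eps^-1.
have ez : eps * z = 1 by rewrite mulfV // gt_eqF.
have z2 : 2 <= z by rewrite -[leLHS]invrK lef_pV2 ?posrE //; lra.
have zn : 2 * z <= n%:R.
  by move: en; rewrite ler_pdivrMr // => en; rewrite -(ler_pM2l e0); lra.
have y0 : 0 <= (z + 2) / 4 by lra.
(* The largest [k] with [eps * (4 * k - 2) <= 1]; it is positive even for
   [eps = 1 / 2]. *)
pose k := Num.truncn ((z + 2) / 4).
have := truncn_itv y0; rewrite -/k => /andP[k1 k2].
have k0 : (0 < k)%N by rewrite -(ltr_nat R); rewrite -natr1 in k2; lra.
have kn : (2 * k <= n)%N by rewrite -(ler_nat R) natrM; lra.
exists (n %/ (2 * k))%N, k.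
set m := (n %/ _)%N.
have m0 : (0 < m)%N by rewrite divn_gt0 ?muln_gt0.
(* As the quotient [m] is at least 1, rounding down loses less than a factor 2. *)
have mn : (n <= 4 * (m * k))%N.
  have := divn_eq n (2 * k); have := ltn_pmod n (_ : 0 < 2 * k)%N.
  rewrite muln_gt0 k0 -/m => /(_ isT); nia.
split.
- by have := leq_trunc_div n (2 * k); rewrite -/m; lia.
- by rewrite !muln_gt0 m0 k0.
- have := ler_wpM2l (ltW e0) k1; lra.
have {}mn : n%:R <= 4 * (m * k)%:R :> R by rewrite -natrM ler_nat.
(* Maximality of [k] gives [z < 4 * k + 2], and [k >= 1] absorbs the 2. *)
have kz : z <= 8 * k%:R.
  have : 1 <= k%:R :> R by rewrite ler1n.
  rewrite -natr1 in k2; lra.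
rewrite -/z [(m * k * k)%N]mulnC natrM.
suff -> : 32 * (k%:R * (m * k)%:R) = 4 * (m * k)%:R * (8 * k%:R) :> R.
  by apply: ler_pM => //; lra.
by ring.
Qed.

Theorem theorem5p1 (R : realType) :
  exists c : R, 0 < c /\
    forall (n : nat) (eps : R),
      (0 < n)%N -> 2 / n%:R <= eps -> eps <= 1 / 2 ->
    forall (s : nat)
      (d1 d2 : measure_display)
      (T1 : measurableType d1) (T2 : measurableType d2)
      (P1 : probability T1 R) (P2 : probability T2 R)
      (sk : T1 -> sgraph n -> seq bool)
      (est : T2 -> {set 'I_n} -> seq bool -> R),
      sketch_measurable sk ->
      est_measurable est ->
      (forall (w : T1) (G : sgraph n), (size (sk w G) <= s)%N) ->
      (forall (G : sgraph n) (S : {set 'I_n}),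
         ((9 / 10)%:E <= (P1 \x P2) (success_event eps sk est G S))%E) ->
      c * (n%:R / eps) <= s%:R.
Proof.
(* [640 = 20 * 32]: the code bound times the loss in the block parameters. *)
exists (1 / 640); split; first lra.
move=> n eps n0 en e2 s d1 d2 T1 T2 P1 P2 sk est msk mest sks succ.
have e0 : 0 < eps by apply: lt_le_trans en; rewrite divr_gt0 // ltr0n.
have [m [k [mkn mk0 ek Nbig]]] := block_parameters n0 en e2.
have [f f_inj] : exists f : 'I_m * bool * 'I_k -> 'I_n, injective f.
  by apply: inj_of_leq_card; rewrite !card_prod !card_ord card_bool.
pose code := code_graph f_inj.
pose u i := left_end f i; pose v i := right_end f i.
pose ok x S := success_event eps sk est (code x) S.
have mok x S : measurable (ok x S) by exact: measurable_success_event.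
have /= := index_lower_bound (P := (P1 \x P2)%E) (s := s)
  (enc := fun w x => sk w.1 (code x))
  (dec := fun w b => [set i | 1 <= est w.2 [set u i] b + est w.2 [set v i] b
                           - est w.2 [set u i; v i] b]%SET)
  (A := fun x i => (ok x [set u i]%SET `&` ok x [set v i]%SET `&`
                    ok x [set u i; v i]%SET)%classic).
rewrite !card_prod !card_ord => /(_ mk0 (fun w x => sks w.1 (code x))) bound.
have {bound} : (m * k * k <= 20 * s)%N; first apply: bound.
- by move=> x i; do 2?apply: measurableI.
(* A union bound over the three failures, each of probability at most [1 / 10]; all three queries
   share the same coins. *)
- move=> x i; rewrite (_ : 7 / 10 = (9 / 10 + 9 / 10 - 1) + 9 / 10 - 1); last lra.
  apply: probability_setI; [exact: measurableI|exact: mok| |exact: succ].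
  apply: probability_setI; [exact: mok|exact: mok|exact: succ|exact: succ].
- move=> x i w [[wu wv] wuv]; rewrite inE.
  rewrite -(mem_code_graph f_inj).
  apply: (decode_threshold e0 ek _ _ _ wu wv wuv).
  + exact/card_cut_edges1D/left_right_neq.
  + by rewrite mem_code_graph card_cut_left_end.
  + by rewrite mem_code_graph card_cut_right_end.
by rewrite -(ler_nat R) natrM => Ns; lra.
Qed.
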